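(* Let $(L,\vee,\wedge,0,1)$ be a finite chain or $L=M_4$. Then $(\mathrm{DO}(L),\preceq)$ is a sublattice of $(\mathrm{O}(L),\preceq)$.
   Context: $M_4=\{0,b_1,b_2,1\}$ is the four-element lattice with bottom $0$, top $1$ and two incomparable elements $b_1,b_2$ strictly between them. A derivation on a bounded lattice $L$ is a map $d:L\to L$ with $d(x\wedge y)=(d(x)\wedge y)\vee(x\wedge d(y))$ for all $x,y\in L$; $\mathrm{DO}(L)$ is the set of all derivations on $L$. $\mathrm{O}(L)$ denotes the set of all maps $L\to L$, ordered by $d\preceq d'$ if and only if $d(x)\leq d'(x)$ for all $x\in L$; it is a lattice with pointwise join and meet. *)

(* Defs.v *)
From HB Require Import structures.
From mathcomp Require Import all_boot all_order.
From mathcomp Require Import boolp.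

Set Implicit Arguments.
Unset Strict Implicit.
Unset Printing Implicit Defensive.

Import Order.Theory.

Local Open Scope order_scope.

Definition derivation (disp : Order.disp_t) (L : tbLatticeType disp)
    (d : L -> L) : Prop :=
  forall x y : L, d (x `&` y) = (d x `&` y) `|` (x `&` d y).

(* The lattice O(L) is the type L -> L with the pointwise lattice structure
   of boolp: see lefP, meetfE and joinfE. *)
Definition DO (disp : Order.disp_t) (L : tbLatticeType disp) : {pred L -> L} :=
  [pred d : L -> L | `[< derivation d >]].
Arguments DO {disp} L _.

(* Following the usual convention, a sublattice is nonempty. *)
Definition sublattice (disp : Order.disp_t) (T : latticeType disp)
    (S : {pred T}) : Prop :=
  [/\ exists u : T, u \in S, meet_closed S & join_closed S].

Definition chain (disp : Order.disp_t) (L : porderType disp) : Prop :=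
  total (<=%O : rel L).

(* L is M_4 up to isomorphism. *)
Definition is_M4 (disp : Order.disp_t) (L : tbLatticeType disp) : Prop :=
  exists b1 b2 : L,
    [/\ \bot < b1 < \top, \bot < b2 < \top, b1 >< b2
      & forall x : L, x \in [:: \bot; b1; b2; \top]].

(* Main.v *)
Require Import Defs.
From mathcomp Require Import all_boot all_order.
From mathcomp Require Import boolp.

(** Chains and M_4 share two properties: they are distributive
    ([chain_distributive], [M4_distributive]), and any two of their elements
    are comparable or have meet \bot ([chain_comparable_or_disjoint],
    [M4_comparable_or_disjoint]).  The second property makes the derivation
    identity trivial on incomparable pairs, so that, by [derivationP], a map d
    is a derivation if and only if d x <= x for all x, and x `&` d y <= d x
    whenever x <= y.  These two families of inequalities are clearly preserved
    by pointwise meet; distributivity makes them stable under pointwise join as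
    well.  The constant map \bot is a derivation, so DO(L) is nonempty. *)

Set Implicit Arguments.
Unset Strict Implicit.
Unset Printing Implicit Defensive.

Import Order.Theory.

Local Open Scope order_scope.

Section Derivations.

Variables (disp : Order.disp_t) (L : tbLatticeType disp).

Lemma derivation_le (d : L -> L) : derivation d -> forall x, d x <= x.
Proof. by move=> der x; rewrite -{1}[x]meetxx der leUx leIr leIl. Qed.

Lemma derivation_meet_le (d : L -> L) :
  derivation d -> forall x y, x <= y -> x `&` d y <= d x.
Proof. by move=> der x y le_xy; rewrite -{2}(meet_l le_xy) der leUr. Qed.

Lemma derivationP (d : L -> L) :
    (forall x y : L, x >=< y \/ x `&` y = \bot) ->
  derivation d <->
    (forall x, d x <= x) /\ (forall x y, x <= y -> x `&` d y <= d x).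
Proof.
move=> cmp; split=> [der|[d_le d_meet] x y].
  by split; [exact: derivation_le | exact: derivation_meet_le].
have d_comparable u v : u <= v -> d u = (d u `&` v) `|` (u `&` d v).
  move=> le_uv; rewrite (meet_l (le_trans (d_le u) le_uv)).
  by rewrite join_l // d_meet.
case: (cmp x y) => [/orP[le_xy|le_yx]|xy0].
- by rewrite (meet_l le_xy) -d_comparable.
- by rewrite (meet_r le_yx) joinC (meetC x) (meetC _ y) -d_comparable.
- (* All three terms lie below x `&` y = \bot. *)
  have /eqP -> : d (x `&` y) == \bot by rewrite -lex0 -xy0.
  have /eqP -> : d x `&` y == \bot by rewrite -lex0 -xy0 leI2.
  have /eqP -> : x `&` d y == \bot by rewrite -lex0 -xy0 leI2.
  by rewrite joinxx.
Qed.

Lemma derivation_bot : derivation (fun _ : L => \bot).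
Proof. by move=> x y; rewrite meet0x meetx0 joinxx. Qed.

Lemma sublattice_DO :
    left_distributive (@Order.meet _ L) Order.join ->
    (forall x y : L, x >=< y \/ x `&` y = \bot) ->
  sublattice (DO L).
Proof.
move=> distr cmp; split.
- by exists (fun=> \bot); apply/asboolP; exact: derivation_bot.
- move=> d e /asboolP/(derivationP _ cmp)[d_le d_meet].
  move=> /asboolP/(derivationP _ cmp)[_ e_meet].
  apply/asboolP/(derivationP _ cmp); split=> [x|x y le_xy]; rewrite !meetfE.
    by rewrite leIxl.
  by rewrite -{1}[x]meetxx meetACA leI2 ?d_meet ?e_meet.
- move=> d e /asboolP/(derivationP _ cmp)[d_le d_meet].
  move=> /asboolP/(derivationP _ cmp)[e_le e_meet].
  apply/asboolP/(derivationP _ cmp); split=> [x|x y le_xy]; rewrite !joinfE.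
    by rewrite leUx d_le e_le.
  by rewrite meetC distr ![_ `&` x]meetC leU2 ?d_meet ?e_meet.
Qed.

Lemma chain_distributive :
  chain L -> left_distributive (@Order.meet _ L) Order.join.
Proof.
move=> tot x y z; wlog le_xy : x y / x <= y => [wlog_le|].
  case/orP: (tot x y) => [|le_yx]; first exact: wlog_le.
  by rewrite joinC wlog_le // joinC.
by rewrite (join_r le_xy) join_r // leI2.
Qed.

Lemma chain_comparable_or_disjoint :
  chain L -> forall x y : L, x >=< y \/ x `&` y = \bot.
Proof. by move=> tot x y; left; exact: tot. Qed.

(** Any other value of the meet or of the join of the two middle elements
    would make them comparable or equal to a bound. *)
Lemma M4_complements (b1 b2 : L) :
    [/\ \bot < b1 < \top, \bot < b2 < \top, b1 >< b2
      & forall x : L, x \in [:: \bot; b1; b2; \top]] ->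
  b1 `&` b2 = \bot /\ b1 `|` b2 = \top.
Proof.
case=> /andP[b1_gt0 b1_lt1] /andP[_ _]; rewrite /Order.comparable.
rewrite negb_or => /andP[nle12 nle21] elts; split.
- move: (elts (b1 `&` b2)); rewrite !inE => /or4P[]/eqP // meetE.
  + by case/negP: nle12; rewrite -meetE leIr.
  + by case/negP: nle21; rewrite -meetE leIl.
  + by move: b1_lt1; rewrite -meetE => /lt_geF; rewrite leIl.
- move: (elts (b1 `|` b2)); rewrite !inE => /or4P[]/eqP // joinE.
  + by move: b1_gt0; rewrite -joinE => /lt_geF; rewrite leUl.
  + by case/negP: nle21; rewrite -joinE leUr.
  + by case/negP: nle12; rewrite -joinE leUl.
Qed.

Lemma M4_distributive :
  is_M4 L -> left_distributive (@Order.meet _ L) Order.join.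
Proof.
move=> [b1 [b2 M4]]; have [meet12 join12] := M4_complements M4.
have [_ _ _ elts] := M4 => x y z.
have meet21 : b2 `&` b1 = \bot by rewrite meetC.
have join21 : b2 `|` b1 = \top by rewrite joinC.
(* The laws of \bot and \top, idempotence and the complement identities form
   the complete meet and join tables of M_4. *)
pose tables := (meet0x, meetx0, meet1x, meetx1, meetxx, meet12, meet21,
                join0x, joinx0, join1x, joinx1, joinxx, join12, join21).
move: (elts x) (elts y) (elts z); rewrite !inE.
by do 3![case/or4P=> /eqP->]; rewrite !tables.
Qed.

Lemma M4_comparable_or_disjoint :
  is_M4 L -> forall x y : L, x >=< y \/ x `&` y = \bot.
Proof.
move=> [b1 [b2 M4]] x y; have [meet12 _] := M4_complements M4.
have [_ _ _ elts] := M4; rewrite /Order.comparable.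
move: (elts x) (elts y); rewrite !inE.
by do 2![case/or4P=> /eqP->]; rewrite ?le0x ?lex1 ?lexx ?orbT;
  by [left | right; rewrite ?meet12 // meetC meet12].
Qed.

End Derivations.

Theorem proposition4p20 (disp : Order.disp_t) (L : finTBLatticeType disp)
    (hL : chain L \/ is_M4 L) :
  sublattice (DO L).
Proof.
case: hL => [tot|M4]; apply: sublattice_DO.
- exact: chain_distributive.
- exact: chain_comparable_or_disjoint.
- exact: M4_distributive.
- exact: M4_comparable_or_disjoint.
Qed.
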